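(* Let $\overline{p}=(p_i)_{i\geq 1}$ be a sequence in $]0,1]$ and let $S$ be the transition operator of the stochastic Fibonacci adding machine associated to $\overline{p}$, acting on $l^\infty(\mathbb{N})$. Let $E:=\{\lambda\in\mathbb{C}:(q_{F_n}(\lambda))_{n\geq 0}\text{ is bounded}\}$. Then $\sigma_{pt}(S)\subset E$, and $$E=\{z\in\mathbb{C}:(\psi_n(z,z))_{n\geq 0}\text{ is bounded}\},$$ where $\psi_n=g_n\circ g_{n-1}\circ\cdots\circ g_0$ and $g_n:\mathbb{C}^2\to\mathbb{C}^2$ are the maps $g_0(x,y)=\left(\frac{x-(1-p_1)}{p_1},\frac{y-(1-p_1)}{p_1}\right)$ and $g_n(x,y)=\left(\frac{1}{r_n}xy-\left(\frac{1}{r_n}-1\right),x\right)$ for all $n\geq 1$, with $r_n=p_{\left[\frac{n+1}{2}\right]+1}$.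
   Context: $\mathbb{N}=\{0,1,2,\ldots\}$. Fibonacci numbers: $F_0=1$, $F_1=2$, $F_n=F_{n-1}+F_{n-2}$ for $n\geq 2$. Every $N\in\mathbb{N}$ has a unique Fibonacci expansion $N=\sum_{i\geq 0}\varepsilon_i(N)F_i$ with $\varepsilon_i(N)\in\{0,1\}$, finitely many nonzero digits, and no two consecutive digits both equal to $1$. $[x]$ denotes the integer part of $x$. Stochastic Fibonacci adding machine: let $\overline{p}=(p_i)_{i\geq 1}\subset\,]0,1]$. It is the Markov chain on $\mathbb{N}$ whose one-step transition from a state $N$ with digits $\varepsilon_i=\varepsilon_i(N)$ is as follows. Draw independent random variables $(e_i)_{i\geq 0}$ with $e_i=1$ with probability $p_{i+1}$ and $e_i=0$ with probability $1-p_{i+1}$ (drawn afresh at each step). Put $c_{-1}=1$. The new state is $N'=\sum_i\varepsilon'_iF_i$, where: (a) if $\varepsilon_0=0$, then for all $i\geq 0$: $\varepsilon'_{2i}=\left[\frac{\varepsilon_{2i}+e_ic_{i-1}}{e_i\varepsilon_{2i+1}c_{i-1}+1}\right]$, $\varepsilon'_{2i+1}=\left[\frac{\varepsilon_{2i+1}}{e_ic_{i-1}+1}\right]$, $c_i=e_ic_{i-1}\varepsilon_{2i+1}$; (b) if $\varepsilon_0=1$, then $\varepsilon'_0=\left[\frac{1}{e_0+1}\right]$, $c_0=e_0$, and for all $i\geq 1$: $\varepsilon'_{2i-1}=\left[\frac{\varepsilon_{2i-1}+e_ic_{i-1}}{e_i\varepsilon_{2i}c_{i-1}+1}\right]$,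 $\varepsilon'_{2i}=\left[\frac{\varepsilon_{2i}}{e_ic_{i-1}+1}\right]$, $c_i=e_ic_{i-1}\varepsilon_{2i}$. $S=(S_{i,j})_{i,j\geq 0}$ is the transition matrix ($S_{i,j}$ is the one-step probability of moving from $i$ to $j$), acting on bounded complex sequences by $(Sv)_i=\sum_{j\geq 0}S_{i,j}v_j$. The point spectrum $\sigma_{pt}(S)$ is the set of $\lambda\in\mathbb{C}$ such that $S-\lambda I$ is not one-to-one on $l^\infty(\mathbb{N})$. The functions $q_{F_n}$: with $r_n=p_{\left[\frac{n+1}{2}\right]+1}$ for $n\geq 1$, $q_{F_0}(\lambda)=\frac{\lambda-(1-p_1)}{p_1}$, $q_{F_1}(\lambda)=\frac{1}{p_2}q_{F_0}(\lambda)^2-\left(\frac{1}{p_2}-1\right)$, and $q_{F_n}(\lambda)=\frac{1}{r_n}q_{F_{n-1}}(\lambda)q_{F_{n-2}}(\lambda)-\left(\frac{1}{r_n}-1\right)$ for $n\geq 2$. *)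

(* Defs.v *)
From mathcomp Require Import all_boot all_order all_algebra.
From mathcomp Require Import finmap complex.
From mathcomp Require Import all_classical all_reals all_analysis.

Set Implicit Arguments.
Unset Strict Implicit.
Unset Printing Implicit Defensive.

Import Order.TTheory GRing.Theory Num.Theory.
Import numFieldNormedType.Exports.

Local Open Scope classical_set_scope.
Local Open Scope ring_scope.
Local Open Scope complex_scope.

(* [F 0 = 1], [F 1 = 2]: shifted with respect to the usual convention. *)
Fixpoint fibo (n : nat) : nat :=
  if n is n'.+1 then
    if n' is n''.+1 then (fibo n' + fibo n'')%N else 2%N
  else 1%N.

(* The sum of a family with infinite support would be 0 by convention of
   [\sum_(i \in _)]; every digit sequence used below has finite support. *)
Definition fib_value (eps : nat -> nat) : nat :=
  \sum_(i \in [set: nat]) (eps i * fibo i)%N.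

Definition fib_expansion (N : nat) (eps : nat -> nat) : Prop :=
  [/\ forall i, (eps i <= 1)%N,
      finite_set [set i | eps i != 0%N],
      forall i, ~ (eps i = 1%N /\ eps i.+1 = 1%N)
    & N = fib_value eps].

(* The digits [eps_i(N)]; the default value is irrelevant, as every natural
   number has exactly one Fibonacci expansion. *)
Definition fib_digit (N : nat) : nat -> nat :=
  xget (fun=> 0%N) [set eps | fib_expansion N eps].

Section AddingMachineStep.
Variables (eps : nat -> nat) (e : nat -> bool).

(* Carries are shifted by one: [carry i] is c_(i-1), so [carry 0] is
   c_(-1) = 1.  In the case eps_0 = 1, c_0 = e_0 is e_0 * c_(-1) * eps_0. *)
Fixpoint carry_even (i : nat) : nat :=
  if i is j.+1 then (e j * carry_even j * eps (2 * j).+1)%N else 1%N.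

Fixpoint carry_odd (i : nat) : nat :=
  if i is j.+1 then (e j * carry_odd j * eps (2 * j))%N else 1%N.

(* [(a %/ b)%N] is the integer part of a / b.  The block containing the
   position k is {2i, 2i+1} with [i = k./2] in the case eps_0 = 0, and
   {2i-1, 2i} with [i = uphalf k] in the case eps_0 = 1. *)
Definition new_digit_even (k : nat) : nat :=
  let i := k./2 in
  if odd k then (eps k %/ (e i * carry_even i + 1))%N
  else ((eps k + e i * carry_even i)
          %/ (e i * eps k.+1 * carry_even i + 1))%N.

Definition new_digit_odd (k : nat) : nat :=
  let i := uphalf k in
  if k == 0%N then (1 %/ (e 0%N + 1))%N
  else if odd k then ((eps k + e i * carry_odd i)
                        %/ (e i * eps k.+1 * carry_odd i + 1))%N
  else (eps k %/ (e i * carry_odd i + 1))%N.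

Definition new_digit (k : nat) : nat :=
  if eps 0%N == 0%N then new_digit_even k else new_digit_odd k.

End AddingMachineStep.

Definition next_state (N : nat) (e : nat -> bool) : nat :=
  fib_value (new_digit (fib_digit N) e).

Definition mutually_independent d (Omega : measurableType d) (R : realType)
    (P : probability Omega R) d' (T : measurableType d')
    (X : nat -> {RV P >-> T}) : Prop :=
  forall (I : {fset nat}) (B : nat -> set T),
    (forall i, measurable (B i)) ->
    P (\bigcap_(i in [set` I]) (X i @^-1` B i)) =
    (\prod_(i <- I) P (X i @^-1` B i))%E.

(* The family p_1, p_2, ... is read off [p : nat -> R] with the same indices;
   [p 0] is never used. *)
Definition adding_machine_draws d (Omega : measurableType d) (R : realType)
    (P : probability Omega R) (p : nat -> R)
    (e : nat -> {RV P >-> bool}) : Prop :=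
  [/\ mutually_independent e,
      forall i, P (e i @^-1` [set true]) = (p i.+1)%:E
    & forall i, P (e i @^-1` [set false]) = (1 - p i.+1)%:E].

Definition transition_matrix d (Omega : measurableType d) (R : realType)
    (P : probability Omega R) (e : nat -> {RV P >-> bool}) (i j : nat) : R :=
  fine (P [set w | next_state i (fun k => e k w) = j]).

Section Operator.
Variable R : realType.

(* [R[i]^o] is the field [R[i]] seen as a normed space over itself. *)
Definition linfty : set (nat -> R[i]) :=
  [set v | bounded_fun (v : nat -> R[i]^o)].

Definition matrix_operator (S : nat -> nat -> R) (v : nat -> R[i]) :
    nat -> R[i] :=
  fun i => limn (series (fun j => (S i j)%:C * v j : R[i]^o)).

Definition point_spectrum (S : nat -> nat -> R) : set R[i] :=
  [set lambda | ~ set_inj linfty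
     (fun v : nat -> R[i] => fun i => matrix_operator S v i - lambda * v i)].

End Operator.

Section Dynamics.
Variables (R : realType) (p : nat -> R).

Definition r_ (n : nat) : R := p (n.+1 %/ 2).+1.

Fixpoint q_ (n : nat) (lambda : R[i]) : R[i] :=
  match n with
  | 0 => (lambda - (1 - p 1%N)%:C) / (p 1%N)%:C
  | n'.+1 =>
    match n' with
    | 0 => ((p 2%N)^-1)%:C * q_ n' lambda ^+ 2 - ((p 2%N)^-1 - 1)%:C
    | n''.+1 => ((r_ n)^-1)%:C * (q_ n' lambda * q_ n'' lambda)
                - ((r_ n)^-1 - 1)%:C
    end
  end.

Definition g_ (n : nat) (z : R[i] * R[i]) : R[i] * R[i] :=
  if n is 0 then
    ((z.1 - (1 - p 1%N)%:C) / (p 1%N)%:C, (z.2 - (1 - p 1%N)%:C) / (p 1%N)%:C)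
  else (((r_ n)^-1)%:C * (z.1 * z.2) - ((r_ n)^-1 - 1)%:C, z.1).

Fixpoint psi_ (n : nat) : R[i] * R[i] -> R[i] * R[i] :=
  if n is n'.+1 then g_ n \o psi_ n' else g_ 0.

Definition bounded_q_set : set R[i] :=
  [set lambda | bounded_fun ((fun n => q_ n lambda) : nat -> R[i]^o)].

End Dynamics.

(* Main.v *)
Require Import Defs.
From mathcomp Require Import all_boot all_order all_algebra.
From mathcomp Require Import finmap complex.
From mathcomp Require Import all_classical all_reals all_analysis.
From mathcomp Require Import zify ring.

Set Implicit Arguments.
Unset Strict Implicit.
Unset Printing Implicit Defensive.

Import Order.TTheory GRing.Theory Num.Theory.
Import numFieldNormedType.Exports.

Local Open Scope classical_set_scope.
Local Open Scope ring_scope.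

(** Let [b] be the lowest digit of [N] and read the digits of [N] at the
    positions [1 - b], [3 - b], [5 - b] and so on: the carry travels through
    those equal to 1, say the first [s] of them.  Since
    [F_(2m-b) - 1] is the sum of the [F_i] at the first [m] of these positions,
    one step of the machine moves [N] to [N + 1 - F_(2m-b)] with probability
    [p_1 ... p_m (1 - p_(m+1))] for each [m <= s] (the draws fail for the first
    time at [m], where [2m - b] is truncated at 0), and to [N + 1] with
    probability [p_1 ... p_(s+1)].  This is [next_stateE] and
    [transition_matrixE]; it uses that Fibonacci expansions are unique, and
    the digits of all possible new states are explicit: the lowest [2m - b]
    digits are erased, and for [N + 1] the digit [2s - b] is then set to 1.

    Hence [(S - lambda) u = 0] is a recursion that gives [u (N + 1)] from the
    previous values, as [p_1 ... p_(s+1)] is not 0.  The product of the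
    [q_(F_i)(lambda)] over the nonzero digits [i] of [N] satisfies the same
    recursion: this is a telescoping sum based on
    [q_(2k-b) q_(2k+1-b) = p_(k+2) q_(2k+2-b) + (1 - p_(k+2))], which is the
    definition of the [q]'s ([q_slot], [fib_prod_telescope]).  So
    [u N = u 0 * (this product)] ([eigenvector_fib_prod]).  A nonzero [u] has
    [u 0 != 0], and [q_(F_n)(lambda) = u (F_n) / u 0] is bounded when [u] is.

    The second description of the set of bounded orbits holds because
    [psi_n (z, z)] is the pair [(q_(F_n)(z), q_(F_(n-1))(z))]. *)

(** * Fibonacci expansions *)

Local Arguments fibo : simpl nomatch.

Lemma fiboSS n : fibo n.+2 = (fibo n.+1 + fibo n)%N.
Proof. by []. Qed.

Lemma fibo_gt0 n : (0 < fibo n)%N.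
Proof.
elim/ltn_ind: n => -[|[|n]] // ih.
by rewrite fiboSS addn_gt0 ih.
Qed.

Lemma fib_value_ord (eps : nat -> nat) n :
  (forall i, (n <= i)%N -> eps i = 0%N) ->
  fib_value eps = (\sum_(i < n) eps i * fibo i)%N.
Proof.
move=> eps0; rewrite (fsbig_ord _ n (fun i => eps i * fibo i)%N) /fib_value.
apply/esym/fsbig_widen => // i [_ /= /negP].
by rewrite -leqNgt => /eps0 ->; rewrite mul0n.
Qed.

Lemma fib_expansionP N eps :
  fib_expansion N eps <-> exists n,
    [/\ forall i, (eps i <= 1)%N, forall i, ~ (eps i = 1%N /\ eps i.+1 = 1%N),
      forall i, (n <= i)%N -> eps i = 0%N
    & N = (\sum_(i < n) eps i * fibo i)%N].
Proof.
split=> [[le1 fin sep ->]|[n [le1 sep eps0 ->]]].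
  have [X XE] := finite_fsetP.1 fin.
  pose n := (\max_(i <- X) i).+1; exists n.
  have eps0 i : (n <= i)%N -> eps i = 0%N.
    move=> ni; apply/eqP; apply: contraTT ni => epsi.
    rewrite -ltnNge /n ltnS; apply: leq_bigmax_seq => //.
    by have : [set` X] i by rewrite -XE.
  by split=> //; exact: fib_value_ord.
split=> //; last by rewrite (fib_value_ord eps0).
apply: (sub_finite_set _ (finite_II n)) => i /= epsi.
by apply: contraNT epsi; rewrite -leqNgt => /eps0 ->.
Qed.

Lemma fib_sum_lt (eps : nat -> nat) n :
  (forall i, (eps i <= 1)%N) -> (forall i, ~ (eps i = 1%N /\ eps i.+1 = 1%N)) ->
  (\sum_(i < n) eps i * fibo i < fibo n)%N.
Proof.
move=> le1 sep; elim/ltn_ind: n => -[|[|n]] ih.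
- by rewrite big_ord0.
- by rewrite big_ord1 /=; have := le1 0%N; lia.
have := ih n.+1 (ltnSn _); have := ih n (leqnSn _).
rewrite fiboSS !big_ord_recr; set S := (\sum_(i < n) _)%N => /=.
move: (fibo n) (fibo n.+1) (le1 n.+1) (le1 n) (sep n) => f f'.
case: (eps n.+1) => [|[|k]] // _; case: (eps n) => [|[|l]] // _; lia.
Qed.

Lemma fib_expansion_unique N eps eps' :
  fib_expansion N eps -> fib_expansion N eps' -> eps = eps'.
Proof.
move=> /fib_expansionP[n [le1 sep eps0 N1]].
move=> /fib_expansionP[n' [le1' sep' eps0' N2]].
pose m := maxn n n'.
have eps0m i : (m <= i)%N -> eps i = 0%N.
  by move=> mi; apply: eps0; exact: leq_trans (leq_maxl _ _) mi.
have eps0m' i : (m <= i)%N -> eps' i = 0%N.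
  by move=> mi; apply: eps0'; exact: leq_trans (leq_maxr _ _) mi.
have : (\sum_(i < m) eps i * fibo i = \sum_(i < m) eps' i * fibo i)%N.
  by rewrite -(fib_value_ord eps0m) -(fib_value_ord eps0m')
       (fib_value_ord eps0) (fib_value_ord eps0') -N1 -N2.
suff agree k : (\sum_(i < k) eps i * fibo i = \sum_(i < k) eps' i * fibo i)%N ->
    forall i, (i < k)%N -> eps i = eps' i.
  move=> /agree epsE; apply/funext => i; have [/epsE //|mi] := ltnP i m.
  by rewrite eps0m ?eps0m'.
elim: k => // k ih; rewrite !big_ord_recr /= => sumE.
have top : eps k = eps' k.
  move: (fib_sum_lt k le1 sep) (fib_sum_lt k le1' sep') (le1 k) (le1' k) sumE.
  move: (\sum_(i < k) eps i * fibo i)%N (\sum_(i < k) eps' i * fibo i)%N (fibo k).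
  move=> x y f; case: (eps k) => [|[|?]] // ltx lty _.
    by case: (eps' k) => [|[|?]] // _; lia.
  by case: (eps' k) => [|[|?]] // _; lia.
move=> i; rewrite ltnS leq_eqVlt => /orP[/eqP-> //|]; apply: ih.
by move: sumE; rewrite top => /addIn.
Qed.

Lemma fib_expansion0 : fib_expansion 0 (fun=> 0%N).
Proof. by apply/fib_expansionP; exists 0%N; split; rewrite ?big_ord0 // => i []. Qed.

Lemma fib_expansion_fibo n : fib_expansion (fibo n) (fun i => (i == n)%N : nat).
Proof.
apply/fib_expansionP; exists n.+1; split.
- by move=> i; case: eqP.
- by move=> i []; case: eqP => // -> _; rewrite gtn_eqF.
- by move=> i ni; rewrite gtn_eqF.
rewrite big_ord_recr /= big1 ?eqxx ?mul1n // => i _.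
by rewrite ltn_eqF ?mul0n.
Qed.

Lemma fib_digitE N eps : fib_expansion N eps -> fib_digit N = eps.
Proof.
move=> epsN; apply: fib_expansion_unique (epsN).
by rewrite /fib_digit; case: xgetP => [e -> //|/(_ eps)].
Qed.

(** * How the carry propagates *)

(** When the carry has passed [m] nonzero digits of an expansion with lowest
    digit [b], it tries to put a 1 at position [2m - b].  Truncation matters
    only for [m = 0], [b = 1], where the carry starts at position 0. *)
Definition slot (b m : nat) : nat := (m.*2 - b)%N.

(** Position of the digit that decides whether the carry goes beyond the
    block [j]. *)
Definition link (b j : nat) : nat := (j.*2.+1 - b)%N.

Definition chain (eps : nat -> nat) (m : nat) : Prop :=
  forall j, (j < m)%N -> eps (link (eps 0%N) j) = 1%N.

Definition erase (eps : nat -> nat) (m i : nat) : nat :=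
  if (i < slot (eps 0%N) m)%N then 0%N else eps i.

Definition carry_up (eps : nat -> nat) (s i : nat) : nat :=
  if i == slot (eps 0%N) s then 1%N else erase eps s i.

(** The quantity [e_i * c_(i-1)] is the indicator of [i < K], where [K] is the
    number of blocks that the carry changes: it stops at [K] either because the
    draw [e_K] fails or because the digit deciding the passage beyond the block
    [K - 1] is 0.  The function [c] stands for both carry sequences of the
    machine. *)
Lemma carry_active (eps : nat -> nat) (f : nat -> bool) (b : nat)
    (c : nat -> nat) (K : nat) :
  c 0%N = 1%N -> (forall i, c i.+1 = (f i * c i * eps (link b i))%N) ->
  (forall j, (j < K)%N -> f j) ->
  (forall j, (j.+1 < K)%N -> eps (link b j) = 1%N) ->
  (forall j, K = j.+1 -> ~~ f K \/ eps (link b j) = 0%N) ->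
  (K = 0%N -> ~~ f 0%N) ->
  forall i, (f i * c i)%N = (i < K)%N.
Proof.
move=> c0 cS fK epsK stop stop0; elim=> [|i ih].
  rewrite c0 muln1; case: K fK {epsK stop} stop0 => [|K] fK stop0.
    by rewrite (negbTE (stop0 _)).
  by rewrite fK.
rewrite cS ih; case: (ltngtP i.+1 K) => [iK|iK|iK].
- by rewrite fK // epsK.
- by rewrite mul0n muln0.
- rewrite mul1n; have [|->] := stop i (esym iK).
    by rewrite iK => /negbTE ->.
  by rewrite muln0.
Qed.

Section Chain.
Variable eps : nat -> nat.
Hypothesis le1 : forall i, (eps i <= 1)%N.
Hypothesis sep : forall i, ~ (eps i = 1%N /\ eps i.+1 = 1%N).

Lemma digit01 i : eps i = 0%N \/ eps i = 1%N.
Proof. by have := le1 i; case: (eps i) => [|[|]] //; [left|right]. Qed.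

Lemma digit_succ i : eps i = 1%N -> eps i.+1 = 0%N.
Proof. by move=> epsi; case: (digit01 i.+1) => // epsi1; case: (sep (i := i)). Qed.

Lemma digit_pred i : eps i.+1 = 1%N -> eps i = 0%N.
Proof. by move=> epsi; case: (digit01 i) => // epsi1; case: (sep (i := i)). Qed.

Lemma chain_slot s : chain eps s -> eps (link (eps 0%N) s) = 0%N ->
  eps (slot (eps 0%N) s) = 0%N.
Proof.
rewrite /chain /link /slot.
case: (digit01 0) => eps0; rewrite eps0; case: s => [|s] // ch.
- by move=> _; apply: digit_succ; rewrite -(ch s) //; congr eps; lia.
- move=> _; rewrite (_ : s.+1.*2 - 1 = (s.*2).+1)%N; last lia.
  by apply: digit_succ; rewrite -(ch s) //; congr eps; lia.
Qed.

(** Digits below [slot m] that are not links are 0, being neighbours of a 1, so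
    the sum is [F_1 + F_3 + ... + F_(2m-1) = F_(2m) - 1] or
    [F_0 + F_2 + ... + F_(2m-2) = F_(2m-1) - 1]. *)
Lemma chain_sum m : chain eps m ->
  (\sum_(0 <= i < slot (eps 0%N) m) eps i * fibo i).+1%N =
    fibo (slot (eps 0%N) m).
Proof.
rewrite /chain /link /slot; case: (digit01 0) => eps0; rewrite eps0.
  elim: m => [|m ih] ch; first by rewrite big_geq.
  have epsm : eps m.*2.+1 = 1%N by rewrite -(ch m) // subn0.
  rewrite subn0 doubleS !big_nat_recr //= epsm (digit_pred epsm) ?fiboSS.
  have := ih (fun j jm => ch j (leqW jm)); rewrite subn0 mul0n addn0 mul1n => <-.
  by rewrite addnC addnS.
elim: m => [|[|m] ih] ch; first by rewrite big_geq.
  by rewrite (_ : 1.*2 - 1 = 1)%N // big_nat1 eps0.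
have epsm : eps m.*2 = 1%N by rewrite -(ch m) //; congr eps; lia.
have epsm2 : eps m.*2.+2 = 1%N by rewrite -(ch m.+1) //; congr eps; lia.
rewrite (_ : m.+2.*2 - 1 = m.*2.+3)%N; last lia.
rewrite 2?big_nat_recr //= epsm2 (digit_succ epsm) ?fiboSS.
have := ih (fun j jm => ch j (leqW jm)).
rewrite (_ : m.+1.*2 - 1 = m.*2.+1)%N; last lia.
by rewrite mul0n addn0 mul1n => <-; rewrite addnC addnS.
Qed.

(** Shifting positions by the lowest digit makes the two cases of the machine
    coincide: [k] lies in the block [(k + eps 0) / 2], as its first element if
    [k + eps 0] is even and as its second one if it is odd.  Position 0 with
    [eps 0 = 1] is the second element of the block 0. *)
Lemma new_digitE (f : nat -> bool) (K k : nat) :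
  (forall j, (j < K)%N -> f j) ->
  (forall j, (j.+1 < K)%N -> eps (link (eps 0%N) j) = 1%N) ->
  (forall j, K = j.+1 -> ~~ f K \/ eps (link (eps 0%N) j) = 0%N) ->
  (K = 0%N -> ~~ f 0%N) ->
  new_digit eps f k =
    if ((k + eps 0%N)./2 < K)%N then
      if odd (k + eps 0%N) then 0%N else ((eps k).+1 %/ (eps k.+1).+1)%N
    else eps k.
Proof.
move=> fK epsK stop stop0; rewrite /new_digit.
case: (digit01 0) => eps0; rewrite eps0 in epsK stop *; rewrite /=.
  have act : forall i, (f i * carry_even eps f i)%N = (i < K)%N.
    apply: (carry_active _ _ fK epsK stop stop0) => // i /=.
    by rewrite /link subn0 mul2n.
  rewrite /new_digit_even addn0 (mulnAC (f _)) !act.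
  case: ltnP => _; case: odd => //=.
  - by rewrite divn_small // addn1 ltnS.
  - by rewrite addn1 mul1n addn1.
  - by rewrite add0n divn1.
  - by rewrite addn0 mul0n add0n divn1.
have act : forall i, (f i * carry_odd eps f i)%N = (i < K)%N.
  apply: (carry_active _ _ fK epsK stop stop0) => // i /=.
  by rewrite /link subn1 mul2n.
rewrite /new_digit_odd (addn1 k) (mulnAC (f _)) !act uphalfE.
have [-> /=|k0] := eqVneq k 0%N.
  by have := act 0%N; rewrite muln1 => ->; rewrite eps0; case: ltnP.
rewrite oddS; case: ltnP => _; case: odd => //=.
- by rewrite addn1 mul1n addn1.
- by rewrite divn_small // addn1 ltnS.
- by rewrite addn0 mul0n add0n divn1.
- by rewrite add0n divn1.
Qed.

Lemma new_digit_erase (f : nat -> bool) (m : nat) : chain eps m ->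
  (forall j, (j < m)%N -> f j) -> f m = false -> new_digit eps f = erase eps m.
Proof.
move=> ch fm fmF; apply/funext => k; rewrite (@new_digitE f m k) //.
- rewrite /erase /slot.
  have -> : (k < m.*2 - eps 0%N)%N = ((k + eps 0%N)./2 < m)%N by lia.
  case: ltnP => // km; case: ifP => // evenk.
  have epsk : eps k.+1 = 1%N.
    by rewrite -(ch _ km) /link; congr eps; lia.
  by rewrite epsk (digit_pred epsk).
- by move=> j jm; apply: ch; exact: ltnW.
- by move=> j _; left; rewrite fmF.
- by move=> m0; rewrite m0 in fmF; rewrite fmF.
Qed.

Lemma new_digit_carry (f : nat -> bool) (s : nat) : chain eps s ->
  eps (link (eps 0%N) s) = 0%N -> (forall j, (j <= s)%N -> f j) ->
  new_digit eps f = carry_up eps s.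
Proof.
move=> ch epss fs; apply/funext => k; rewrite (@new_digitE f s.+1 k) //; last first.
  by move=> j [<-]; right.
have s0 : s = 0%N -> eps 0%N = 0%N.
  move=> s0; move: epss; rewrite s0 /link; case: (digit01 0) => // eps1.
  by rewrite [X in (_ - X)%N]eps1.
have slots := chain_slot ch epss; rewrite /carry_up /erase.
have : (s = 0 /\ eps 0 = 0 \/ 0 < s)%N.
  by case: (posnP s) => ?; [left; split => //; exact: s0 | right].
move=> {}s0; have b1 := le1 0%N; move: slots epss; rewrite /slot /link.
have [ks|sk] := ltnP; last first.
  move=> _ _; rewrite [k == _](_ : _ = false); last by lia.
  by rewrite ifF //; lia.
case: ifP => [oddk|evenk] slots epss.
  rewrite [k == _](_ : _ = false); last by lia.
  case: ifP => // kge; rewrite -epss; congr eps; lia.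
case: eqP => [kE|kN].
  have -> : eps k.+1 = 0%N by rewrite -epss; congr eps; lia.
  by rewrite kE slots.
rewrite ifT; last by lia.
have epsk : eps k.+1 = 1%N.
  by rewrite -(ch (k + eps 0%N)./2) /link; [congr eps; lia | lia].
by rewrite epsk (digit_pred epsk).
Qed.

End Chain.

(** * Expansions of the possible new states *)

Lemma sum_erase (eps : nat -> nat) (m n : nat) : (slot (eps 0%N) m <= n)%N ->
  (\sum_(0 <= i < n) eps i * fibo i =
   \sum_(0 <= i < slot (eps 0%N) m) eps i * fibo i
   + \sum_(0 <= i < n) erase eps m i * fibo i)%N.
Proof.
move=> mn; rewrite (big_cat_nat (leq0n _) mn) //=; congr addn.
rewrite [RHS](big_cat_nat (leq0n _) mn) //=.
rewrite [X in (X + _)%N]big1_seq ?add0n; last first.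
  move=> i; rewrite mem_index_iota => /andP[_ /andP[_ im]].
  by rewrite /erase im mul0n.
by apply: eq_big_nat => i /andP[mi _]; rewrite /erase ltnNge mi.
Qed.

Lemma fib_expansion_chain N eps m : fib_expansion N eps -> chain eps m ->
  N.+1 = (fibo (slot (eps 0%N) m) + fib_value (erase eps m))%N.
Proof.
move=> /fib_expansionP[n [le1 sep eps0 NE]] ch.
have eps0n i : (maxn n (slot (eps 0%N) m) <= i)%N -> eps i = 0%N.
  by move=> ni; apply: eps0; exact: leq_trans (leq_maxl _ _) ni.
rewrite {}NE -(fib_value_ord eps0) (fib_value_ord eps0n).
rewrite (@fib_value_ord (erase eps m) (maxn n (slot (eps 0%N) m))); last first.
  by move=> i /eps0n epsi; rewrite /erase epsi if_same.
rewrite -!(big_mkord xpredT (fun i => _ i * fibo i)%N).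
by rewrite (sum_erase (leq_maxr n _)) -(chain_sum le1 sep ch).
Qed.

Lemma fib_expansion_erase N eps m : fib_expansion N eps -> chain eps m ->
  fib_expansion (N.+1 - fibo (slot (eps 0%N) m)) (erase eps m).
Proof.
move=> epsN ch; rewrite (fib_expansion_chain epsN ch) addKn.
have /fib_expansionP[n [le1 sep eps0 _]] := epsN.
have er0 i : (n <= i)%N -> erase eps m i = 0%N.
  by move=> ni; rewrite /erase (eps0 i) // if_same.
apply/fib_expansionP; exists n; split=> //; last exact: fib_value_ord.
- by move=> i; rewrite /erase; case: ifP.
- move=> i; rewrite /erase; case: ltnP => [_ []//|mi].
  by rewrite ltnNge leqW //; exact: sep.
Qed.

(** The 1 put at the end of the chain has two zero neighbours: the lower one
    has just been erased and the upper one is the link where the chain stops. *)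
Lemma fib_expansion_carry N eps s : fib_expansion N eps -> chain eps s ->
  eps (link (eps 0%N) s) = 0%N -> fib_expansion N.+1 (carry_up eps s).
Proof.
move=> epsN ch epss; rewrite (fib_expansion_chain epsN ch).
have /fib_expansionP[_ [le1 sep _ _]] := epsN.
have slots := chain_slot le1 sep ch epss.
have /fib_expansionP[n [le1' sep' er0 _]] := fib_expansion_erase epsN ch.
set t := slot (eps 0%N) s in slots *.
have er_t : erase eps s t = 0%N by rewrite /erase ltnn.
have er_t1 : erase eps s t.+1 = 0%N.
  rewrite /erase ltnNge leqnSn /= -epss; congr eps.
  move: epss (le1 0%N); rewrite /t /slot /link.
  (* For s = 0 the hypothesis on the link forces the lowest digit to be 0. *)
  case: s {ch slots t er0 le1' sep' er_t} => [|s]; last by lia.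
  case eps0: (eps 0%N) => [|[|]] // epsl _.
  by have := eps0; rewrite (epsl : eps 0%N = 0%N).
have eps0n i : (maxn n t.+1 <= i)%N -> erase eps s i = 0%N.
  by move=> ni; apply: er0; exact: leq_trans (leq_maxl _ _) ni.
have up0 i : (maxn n t.+1 <= i)%N -> carry_up eps s i = 0%N.
  move=> ni; rewrite /carry_up -/t gtn_eqF ?eps0n //.
  exact: leq_trans (leq_maxr _ _) ni.
apply/fib_expansionP; exists (maxn n t.+1); split=> //.
- by move=> i; rewrite /carry_up; case: ifP.
- move=> i; rewrite /carry_up -/t; case: eqP => [->|_].
    by rewrite gtn_eqF // er_t1 => -[].
  case: eqP => [it|_]; last exact: sep'.
  by rewrite /erase -/t -it ltnSn => -[].
rewrite (fib_value_ord eps0n).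
have tn : (t < maxn n t.+1)%N by exact: leq_maxr.
rewrite [RHS](bigD1 (Ordinal tn)) //= [X in (_ + X)%N](bigD1 (Ordinal tn)) //=.
rewrite /carry_up -/t eqxx mul1n er_t mul0n add0n; congr addn.
by apply: eq_bigr => i; rewrite -val_eqE /= => /negbTE ->.
Qed.

Lemma chain_end N eps : fib_expansion N eps ->
  exists s, chain eps s /\ eps (link (eps 0%N) s) = 0%N.
Proof.
move=> /fib_expansionP[n [le1 sep eps0 NE]].
have ex : exists s, eps (link (eps 0%N) s) == 0%N.
  exists n; rewrite eps0 // /link; have := le1 0%N; lia.
exists (ex_minn ex); case: ex_minnP => s /eqP epss smin; split=> // j js.
case: (digit01 le1 (link (eps 0%N) j)) => // /eqP/smin.
by rewrite leqNgt js.
Qed.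

(** * The transition probabilities *)

(** Existence of Fibonacci expansions: adding 1 to an expansion is the action of
    the machine when all draws succeed. *)
Lemma fib_digitP N : fib_expansion N (fib_digit N).
Proof.
elim: N => [|N ih]; first by rewrite (fib_digitE fib_expansion0); exact: fib_expansion0.
have [s [ch epss]] := chain_end ih.
have up := fib_expansion_carry ih ch epss.
by rewrite (fib_digitE up).
Qed.

(** The value [s + 1] means that the draws [0, ..., s] all succeed. *)
Definition first_failure (s : nat) (f : nat -> bool) : nat :=
  find (fun j => ~~ f j) (iota 0 s.+1).

Definition target (eps : nat -> nat) (N s m : nat) : nat :=
  if (m <= s)%N then (N.+1 - fibo (slot (eps 0%N) m))%N else N.+1.

Lemma first_failure_le s f : (first_failure s f <= s.+1)%N.
Proof. by rewrite /first_failure -[leqRHS](size_iota 0) find_size. Qed.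

Lemma before_failure s f j : (j < first_failure s f)%N -> f j.
Proof.
move=> jK; have := before_find 0%N jK.
rewrite nth_iota ?add0n; first by move/negbT/negPn.
exact: leq_trans jK (first_failure_le s f).
Qed.

Lemma at_failure s f : (first_failure s f <= s)%N -> f (first_failure s f) = false.
Proof.
move=> Ks; have : has (fun j => ~~ f j) (iota 0 s.+1).
  by rewrite has_find size_iota ltnS.
move=> /(nth_find 0%N); rewrite nth_iota ?add0n -/(first_failure s f) //.
exact: negbTE.
Qed.

Lemma first_failureP s f m : (m <= s.+1)%N ->
  first_failure s f = m <-> forall i, (i < (minn m s).+1)%N -> f i = (i != m).
Proof.
move=> ms; split=> [<- i|fE].
  rewrite ltnS leq_min => /andP[iK is_].
  have [iE|iNK] := eqVneq i (first_failure s f).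
    by rewrite iE at_failure // -iE.
  by rewrite (before_failure (s := s)) // ltn_neqAle iNK.
case: (ltngtP (first_failure s f) m) => [Km|mK|//].
  have Ks : (first_failure s f <= s)%N by rewrite -ltnS; exact: leq_trans Km ms.
  have := fE (first_failure s f); rewrite at_failure // ltnS leq_min (ltnW Km) Ks.
  by rewrite ltn_eqF // => /(_ isT).
have m_s : (m <= s)%N by rewrite -ltnS; exact: leq_trans mK (first_failure_le _ _).
have := fE m; rewrite (before_failure mK) eqxx ltnS leq_min leqnn m_s.
by move=> /(_ isT).
Qed.

Lemma next_stateE N s f : chain (fib_digit N) s ->
  fib_digit N (link (fib_digit N 0%N) s) = 0%N ->
  next_state N f = target (fib_digit N) N s (first_failure s f).
Proof.
move=> ch epss; have expN := fib_digitP N.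
have /fib_expansionP[n [le1 sep _ _]] := expN.
rewrite /next_state /target; case: ifP => [Ks|/negbT]; last rewrite -ltnNge => sK.
  have chK : chain (fib_digit N) (first_failure s f).
    by move=> j jK; apply: ch; exact: leq_trans jK Ks.
  rewrite (new_digit_erase le1 sep chK); first last.
  - exact: at_failure.
  - by move=> j; exact: before_failure.
  by have [_ _ _ <-] := fib_expansion_erase expN chK.
rewrite (new_digit_carry le1 sep ch epss); last first.
  by move=> j js; apply: (@before_failure s); exact: leq_ltn_trans sK.
by have [_ _ _ <-] := fib_expansion_carry expN ch epss.
Qed.

Section Transition.
Context d (Omega : measurableType d) (R : realType) (P : probability Omega R).
Variables (p : nat -> R) (e : nat -> {RV P >-> bool}).
Hypothesis draws : adding_machine_draws p e.

(** Probability that the first failure among the draws [0, ..., s] is at [m].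
    For [m = s + 1] the product stops at [s], hence the minimum. *)
Definition weight (s m : nat) : R :=
  \prod_(i < (minn m s).+1) (if i == m :> nat then 1 - p i.+1 else p i.+1).

Lemma probability_prefix (l : nat) (b : nat -> bool) :
  P [set w | forall i, (i < l)%N -> e i w = b i] =
  (\prod_(i < l) (if b i then p i.+1 else 1 - p i.+1))%:E.
Proof.
have [indep p1 p0] := draws.
pose I := [fset i in iota 0 l]%fset.
have -> : [set w | forall i, (i < l)%N -> e i w = b i] =
    \bigcap_(i in [set` I]) (e i @^-1` [set b i]).
  apply/seteqP; split=> w /= ew i.
    by rewrite /= in_fset mem_iota add0n => /ew.
  by move=> il; apply: (ew i); rewrite /= in_fset mem_iota.
rewrite (indep I (fun i => [set b i])) // (perm_big (iota 0 l)); last first.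
  apply: uniq_perm; [exact: fset_uniq|exact: iota_uniq|].
  by move=> i; rewrite in_fset.
rewrite -prodEFin.
rewrite -(big_mkord xpredT (fun i => (if b i then p i.+1 else 1 - p i.+1)%:E)).
rewrite /index_iota subn0; apply: eq_bigr => i _.
by case: (b i).
Qed.

Lemma measurable_first_failure s m : (m <= s.+1)%N ->
  measurable [set w | first_failure s (e ^~ w) = m].
Proof.
move=> ms.
have -> : [set w | first_failure s (e ^~ w) = m] =
    \bigcap_(i in [set i | (i < (minn m s).+1)%N]) (e i @^-1` [set i != m]).
  apply/seteqP; split=> w /=; first by move/(first_failureP _ ms).
  by move=> ew; apply/(first_failureP _ ms).
apply: bigcap_measurable => [|i _]; first by exists 0%N.
exact: measurable_funPTI.
Qed.

(** The events that the first failure is [m] partition the sample space, and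
    the new state depends only on [m]. *)
Lemma transition_matrixE N s j : chain (fib_digit N) s ->
  fib_digit N (link (fib_digit N 0%N) s) = 0%N ->
  transition_matrix e N j =
  \sum_(m < s.+2 | target (fib_digit N) N s m == j) weight s m.
Proof.
move=> ch epss; rewrite /transition_matrix.
pose E (m : 'I_s.+2) := [set w | first_failure s (e ^~ w) = m].
have -> : [set w | next_state N (e ^~ w) = j] =
    \big[setU/set0]_(m < s.+2 | target (fib_digit N) N s m == j) E m.
  rewrite -bigcup_seq_cond.
  apply/seteqP; split=> w /=.
    rewrite (next_stateE _ ch epss) => tj.
    exists (Ordinal (first_failure_le s (e ^~ w) : (_ < s.+2)%N)) => //.
    by rewrite /= mem_index_enum; exact/eqP.
  move=> [m /andP[_ /eqP tm]]; rewrite /E /= => ff.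
  by rewrite (next_stateE _ ch epss) ff.
rewrite measure_bigsetU_ord; last first.
- by move=> m m' _ _ [w [/= mE m'E]]; apply: val_inj; rewrite /= -mE -m'E.
- by move=> m; apply: measurable_first_failure; rewrite -ltnS.
rewrite (eq_bigr (fun m : 'I__ => (weight s m)%:E)) ?sumEFin // => m _.
have ms : (m <= s.+1)%N by rewrite -ltnS.
transitivity (P [set w | forall i, (i < (minn m s).+1)%N -> e i w = (i != m)]).
  by congr (P _); apply/seteqP; split=> w /(first_failureP _ ms).
rewrite (probability_prefix _ (fun i => i != m :> nat)) /weight.
by congr EFin; apply: eq_bigr => i _; rewrite if_neg.
Qed.

End Transition.

(** * Eigenvectors *)

Lemma matrix_operator_finite (R : realType) (S : nat -> nat -> R)
    (v : nat -> R[i]) (N n : nat) :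
  (forall j, (n <= j)%N -> S N j = 0) ->
  matrix_operator S v N = \sum_(j < n) (S N j)%:C%C * v j.
Proof.
move=> S0; rewrite /matrix_operator.
apply: (@lim_near_cst R[i]^o); first exact: (@norm_hausdorff _ R[i]^o).
near=> k; have nk : (n <= k)%N by near: k; exact: nbhs_infty_ge.
rewrite /series /= (big_cat_nat (leq0n _) nk) //= [X in _ + X]big_nat_cond.
rewrite [X in _ + X]big1 ?addr0 ?big_mkord // => j /andP[/andP[nj _] _].
by rewrite S0 // mul0r.
Unshelve. all: by end_near.
Qed.

Lemma target_lt eps N s m : (target eps N s m < N.+2)%N.
Proof. by rewrite /target; case: ifP => // _; rewrite ltnS leq_subr. Qed.

Lemma matrix_operatorE d (Omega : measurableType d) (R : realType)
    (P : probability Omega R) (p : nat -> R) (e : nat -> {RV P >-> bool})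
    (v : nat -> R[i]) (N s : nat) :
  adding_machine_draws p e -> chain (fib_digit N) s ->
  fib_digit N (link (fib_digit N 0%N) s) = 0%N ->
  matrix_operator (transition_matrix e) v N =
  \sum_(m < s.+2) (weight p s m)%:C%C * v (target (fib_digit N) N s m).
Proof.
move=> draws ch epss; rewrite (@matrix_operator_finite _ _ _ _ N.+2); last first.
  move=> j Nj; rewrite (transition_matrixE draws _ ch epss) big_pred0 // => m.
  by rewrite ltn_eqF // (leq_trans (target_lt _ _ _ _) Nj).
under eq_bigr => j _.
  rewrite (transition_matrixE draws _ ch epss) rmorph_sum mulr_suml; over.
rewrite (exchange_big_dep xpredT) //=; apply: eq_bigr => m _.
by rewrite (big_pred1 (Ordinal (target_lt (fib_digit N) N s m))).
Qed.

Section Eigenvector.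
Variables (R : realType) (p : nat -> R).
Hypothesis hp : forall i : nat, (1 <= i)%N -> 0 < p i <= 1.
Variable lambda : R[i].

Local Notation q n := (q_ p n lambda).

Lemma p_neq0 i : (p i.+1)%:C%C != 0 :> R[i].
Proof.
rewrite (_ : 0 = 0%:C%C) // (inj_eq (@complexI R)).
by have /andP[/lt0r_neq0] := hp (ltn0Sn i).
Qed.

Lemma lambda_q0 : lambda = (1 - (p 1)%:C%C) + (p 1)%:C%C * q 0%N.
Proof.
rewrite /= mulrCA divff ?p_neq0 // mulr1 rmorphB rmorph1.
by rewrite addrC subrK.
Qed.

(** This is the recursive definition of [q] at the index [2k + 2 - b].  For
    [k = 0], [b = 1] that index is 1 and both factors are [q 0]. *)
Lemma q_slot (b k : nat) : (b <= 1)%N ->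
  q (slot b k) * q (link b k) =
  (1 - (p k.+2)%:C%C) + (p k.+2)%:C%C * q (slot b k.+1).
Proof.
move=> b1; have pn0 := p_neq0 k.+1.
have key n : r_ p n = p k.+2 ->
    (p k.+2)%:C%C * (((r_ p n)^-1)%:C%C * (q n.-1 * q n.-2) - ((r_ p n)^-1 - 1)%:C%C)
    = q n.-1 * q n.-2 - (1 - (p k.+2)%:C%C).
  by move=> ->; rewrite rmorphB rmorph1 fmorphV; field.
suff [n rn [n1 n2 n3]] : exists2 n, r_ p n = p k.+2 &
    [/\ q n = ((r_ p n)^-1)%:C%C * (q n.-1 * q n.-2) - ((r_ p n)^-1 - 1)%:C%C,
        q (slot b k) * q (link b k) = q n.-1 * q n.-2 & n = slot b k.+1].
  by rewrite -n3 n1 n2 (key _ rn) addrC subrK.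
exists (slot b k.+1).
  by rewrite /r_ /slot; congr p; congr S; lia.
have [/andP[/eqP-> /eqP->]|k0b] := boolP ((k == 0%N) && (b == 1%N)).
  by split.
have [n sk] : exists n, slot b k.+1 = n.+2.
  by exists (slot b k.+1 - 2)%N; move: k0b; rewrite /slot; lia.
rewrite sk; split=> //.
rewrite mulrC; congr (q_ p _ lambda * q_ p _ lambda).
all: move: k0b sk; rewrite /slot /link; lia.
Qed.

(** For [n] beyond all nonzero digits this is the product over all of them. *)
Definition fib_prod (n : nat) (eps : nat -> nat) : R[i] :=
  \prod_(i < n) q i ^+ eps i.

Lemma fib_prod_set (n k : nat) (eps eps' : nat -> nat) : (k < n)%N ->
  eps k = 0%N -> (forall i, eps' i = if i == k then 1%N else eps i) ->
  fib_prod n eps' = q k * fib_prod n eps.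
Proof.
move=> kn epsk eps'E; rewrite /fib_prod (bigD1 (Ordinal kn)) //=.
rewrite [in RHS](bigD1 (Ordinal kn)) //= eps'E eqxx epsk expr1 expr0 mul1r.
by congr (_ * _); apply: eq_bigr => i; rewrite -val_eqE eps'E /= => /negbTE ->.
Qed.

Lemma erase_step (eps : nat -> nat) m :
  (forall i, (eps i <= 1)%N) -> (forall i, ~ (eps i = 1%N /\ eps i.+1 = 1%N)) ->
  chain eps m.+1 -> forall i,
  erase eps m i = if i == link (eps 0%N) m then 1%N else erase eps m.+1 i.
Proof.
move=> le1 sep ch i; have epsm := ch m (ltnSn m); have b1 := le1 0%N.
have [->|iN] := eqVneq.
  by rewrite /erase epsm ifF // /slot /link; lia.
rewrite /erase; case: ltnP => [im|mi].
  by rewrite ifT //; move: im; rewrite /slot; lia.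
case: ltnP => // im; apply: (digit_pred le1 sep); rewrite -epsm; congr eps.
by move: im mi iN; rewrite /slot /link; lia.
Qed.

(** Probability that the draws [0, ..., k - 1] all succeed. *)
Definition pass (k : nat) : R[i] := \prod_(i < k) (p i.+1)%:C%C.

Lemma pass_neq0 k : pass k != 0.
Proof. by apply/prodf_neq0 => i _; exact: p_neq0. Qed.

Lemma weight_stop s m : (m <= s)%N ->
  (weight p s m)%:C%C = pass m * (1 - (p m.+1)%:C%C).
Proof.
move=> ms; rewrite /weight (minn_idPl ms) big_ord_recr /= eqxx rmorphM /=.
rewrite rmorphB rmorph1 rmorph_prod; congr (_ * _).
by apply: eq_bigr => i _; rewrite ltn_eqF.
Qed.

Lemma weight_full s : (weight p s s.+1)%:C%C = pass s.+1.
Proof.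
rewrite /weight (minn_idPr (leqnSn s)) rmorph_prod.
by apply: eq_bigr => i _; rewrite ltn_eqF.
Qed.

(** For [k = 0] this is [lambda = (1 - p_1) + p_1 q_0].  In the step, erasing one
    more link takes a factor [q (link k)] out of the product, and [q_slot]
    turns [q (slot k) * q (link k)] into the next summand and the next
    remainder. *)
Lemma fib_prod_telescope (eps : nat -> nat) n k :
  (forall i, (eps i <= 1)%N) -> (forall i, ~ (eps i = 1%N /\ eps i.+1 = 1%N)) ->
  (forall i, (n <= i)%N -> eps i = 0%N) -> chain eps k ->
  lambda * fib_prod n (erase eps 0) =
  \sum_(m < k.+1) pass m * (1 - (p m.+1)%:C%C) * fib_prod n (erase eps m)
  + pass k.+1 * q (slot (eps 0%N) k) * fib_prod n (erase eps k).
Proof.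
move=> le1 sep eps0; elim: k => [|k ih] ch.
  rewrite big_ord1 /pass big_ord0 big_ord1 mul1r -mulrDl; congr (_ * _).
  exact: lambda_q0.
rewrite ih => [|j jk]; last by apply: ch; exact: leqW.
rewrite [in RHS]big_ord_recr /= -addrA; congr (_ + _).
have kn : (link (eps 0%N) k < n)%N.
  by rewrite ltnNge; apply/negP => /eps0; rewrite ch.
rewrite (fib_prod_set kn _ (erase_step le1 sep ch)); last first.
  by rewrite /erase ifT // /link /slot; have := le1 0%N; lia.
rewrite -mulrDl mulrA; congr (_ * _).
rewrite -mulrA q_slot // [in pass k.+2]/pass big_ord_recr /= -/(pass k.+1).
by rewrite mulrDr !mulrA.
Qed.

(** The eigenvalue equation at [N] involves [u] at states at most [N], where the
    formula holds by induction, and at [N + 1].  Comparing it with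
    [fib_prod_telescope] leaves only the last terms, which have the nonzero
    coefficient [pass s.+1]. *)
Lemma eigenvector_fib_prod (u : nat -> R[i]) :
  (forall N s, chain (fib_digit N) s ->
    fib_digit N (link (fib_digit N 0%N) s) = 0%N ->
    lambda * u N = \sum_(m < s.+2)
      (weight p s m)%:C%C * u (target (fib_digit N) N s m)) ->
  forall N n, (forall i, (n <= i)%N -> fib_digit N i = 0%N) ->
    u N = u 0%N * fib_prod n (fib_digit N).
Proof.
move=> eig; elim/ltn_ind => -[|N] ih n.
  rewrite (fib_digitE fib_expansion0) => _.
  by rewrite /fib_prod big1 ?mulr1 // => i _; rewrite expr0.
have expN := fib_digitP N; set eps := fib_digit N in expN.
have /fib_expansionP[_ [le1 sep _ _]] := expN.
have [s [ch epss]] := chain_end expN.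
have up := fib_expansion_carry expN ch epss.
rewrite (fib_digitE up) => up0.
have sn : (slot (eps 0%N) s < n)%N.
  by rewrite ltnNge; apply/negP => /up0; rewrite /carry_up eqxx.
have eps0 i : (n <= i)%N -> eps i = 0%N.
  move=> ni; have := up0 i ni; have si := leq_trans sn ni.
  by rewrite /carry_up gtn_eqF // /erase ltnNge ltnW.
have chm m : (m <= s)%N -> chain eps m.
  by move=> ms j jm; apply: ch; exact: leq_trans jm ms.
have uE m : (m <= s)%N ->
    u (target eps N s m) = u 0%N * fib_prod n (erase eps m).
  move=> ms; have em := fib_expansion_erase expN (chm m ms).
  rewrite /target ms -(fib_digitE em); apply: ih.
    by rewrite ltnS -ltnS ltn_subrL fibo_gt0.
  by move=> i ni; rewrite (fib_digitE em) /erase (eps0 i) // if_same.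
have er0 : erase eps 0 = eps.
  by apply/funext => i; rewrite /erase /slot sub0n.
have u_N : u N = u 0%N * fib_prod n (erase eps 0).
  by rewrite -uE // /target /slot sub0n /= subSS subn0.
have := eig N s ch epss; rewrite u_N mulrCA (fib_prod_telescope le1 sep eps0 ch).
rewrite [in RHS]big_ord_recr /= weight_full [target _ _ _ s.+1]/target ltnn.
rewrite mulrDr mulr_sumr.
rewrite (eq_bigr (fun m : 'I_s.+1 =>
    (weight p s m)%:C%C * u (target (fib_digit N) N s m))); last first.
  move=> m _; have ms : (m <= s)%N by rewrite -ltnS.
  by rewrite (uE _ ms) (weight_stop ms) mulrCA.
move=> /addrI.
rewrite (@fib_prod_set n (slot (eps 0%N) s) (erase eps s) (carry_up eps s)) //; last first.
  by rewrite /erase ltnn; exact: chain_slot.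
by rewrite -mulrA mulrCA => /(mulfI (pass_neq0 _)) ->.
Qed.

End Eigenvector.

(** * Boundedness *)

Lemma bounded_funE (R : realType) (V : pseudoMetricNormedZmodType R[i])
    (f : nat -> V) :
  bounded_fun f <-> exists M : R[i], forall n, `|f n| <= M.
Proof.
have gF : ProperFilter (globally [set: nat]).
  exact: (@globally_properfilter _ _ 0%N).
rewrite /= (ex_bound f); split=> -[M fM]; exists M => n; last by move=> _; exact: fM.
exact: fM.
Qed.

Lemma point_spectrum_bounded_q (R : realType) (p : nat -> R)
    (hp : forall i : nat, (1 <= i)%N -> 0 < p i <= 1)
    (d : measure_display) (Omega : measurableType d)
    (P : probability Omega R) (e : nat -> {RV P >-> bool}) :
  adding_machine_draws p e ->
  point_spectrum (transition_matrix e) `<=` bounded_q_set p.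
Proof.
move=> draws lambda inj; rewrite /bounded_q_set /=.
apply: contrapT => unb; apply: inj => v w.
move=> /set_mem/(@bounded_funE R R[i]^o)[M vM].
move=> /set_mem/(@bounded_funE R R[i]^o)[M' wM'] vw.
apply: contrapT => vNw; apply: unb.
(* [S] acts by finite sums, so the difference of two points with the same
   image under [S - lambda] is an eigenvector. *)
pose u n := v n - w n.
have eig N s : chain (fib_digit N) s ->
    fib_digit N (link (fib_digit N 0%N) s) = 0%N ->
    lambda * u N = \sum_(m < s.+2)
      (weight p s m)%:C%C * u (target (fib_digit N) N s m).
  move=> ch epss; have := congr1 (fun f => f N) vw.
  rewrite /= !(matrix_operatorE _ draws ch epss) /u mulrBr => eqN.
  under eq_bigr do rewrite mulrBr.
  have swap (a b x y : R[i]) : a - x = b - y -> x - y = a - b.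
    by move=> abxy; rewrite -(subrK x a) abxy; ring.
  by rewrite sumrB; exact: swap.
have uE := eigenvector_fib_prod hp eig.
have u0 : u 0%N != 0.
  apply: contra_notN vNw => /eqP u0; apply/funext => N; apply/eqP.
  have /fib_expansionP[n [_ _ sup _]] := fib_digitP N.
  by rewrite -subr_eq0 -/(u N) (uE N n sup) u0 mul0r.
apply/bounded_funE; exists ((M + M') / `|u 0%N|) => n.
have : u (fibo n) = u 0%N * q_ p n lambda.
  have dn := fib_digitE (fib_expansion_fibo n).
  rewrite (uE (fibo n) n.+1) dn; last by move=> i ni; rewrite gtn_eqF.
  rewrite (@fib_prod_set _ _ _ n.+1 n (fun=> 0%N)) //.
  by rewrite /fib_prod big1 ?mulr1 // => i _; rewrite expr0.
move=> un; rewrite ler_pdivlMr ?normr_gt0 // mulrC -normrM -un.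
by apply: (le_trans (ler_normB _ _)); apply: lerD; [exact: vM | exact: wM'].
Qed.

(** For [n = 0] both components are [q_ 0], in accordance with [0.-1 = 0]. *)
Lemma psi_q (R : realType) (p : nat -> R) (z : R[i]) n :
  psi_ p n (z, z) = (q_ p n z, q_ p n.-1 z).
Proof.
elim: n => [|n ih] //; rewrite /= ih.
by case: n {ih} => [|n].
Qed.

Theorem mainTheorem5 (R : realType) (p : nat -> R)
    (hp : forall i : nat, (1 <= i)%N -> 0 < p i <= 1) :
  (forall (d : measure_display) (Omega : measurableType d)
     (P : probability Omega R) (e : nat -> {RV P >-> bool}),
     adding_machine_draws p e ->
     point_spectrum (transition_matrix e) `<=` bounded_q_set p) /\
  bounded_q_set p =
    [set z : R[i] |
      bounded_fun ((fun n => psi_ p n (z, z)) : nat -> R[i]^o * R[i]^o)].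
Proof.
split=> [d Omega P e|]; first exact: point_spectrum_bounded_q.
(* The order of [R[i]] is partial, but norms are comparable. *)
have maxE (x y M : R[i]) : (Num.max `|x| `|y| <= M) = (`|x| <= M) && (`|y| <= M).
  by apply: comparable_ge_max; apply: real_comparable; exact: normr_real.
apply/seteqP; split=> z /= /bounded_funE[M zM]; apply/bounded_funE; exists M => n.
  by rewrite psi_q prod_normE maxE; apply/andP; split; exact: zM.
by have := zM n; rewrite psi_q prod_normE maxE => /andP[].
Qed.
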